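(* Let $n\in\mathbb{Z}_+$ and let $f=f(Z_0,\dots,Z_n)$ be a complex-valued random variable (a function of $Z_0,\dots,Z_n$). Then $$E^{Q_n}(f)=\frac{E^{Q}_{\tilde\varphi_c}\left(\frac{f}{\varphi_c(Z_n)}\right)}{E^{Q}_{\tilde\varphi_c}\left(\frac{1}{\varphi_c(Z_n)}\right)},$$ where $\tilde\varphi_c$ is the probability measure obtained by conditioning the probability measure $\varphi_c$ on ${\cal L}_0$.
   Context: $\mathbb{Z}_+=\{0,1,2,\dots\}$. Fix $L\in\mathbb{N}$ and $c_1,\dots,c_L\in\mathbb{Z}_+$ with $c_1c_L>0$ and $(L,c_1)\neq(1,1)$. Under a probability measure $P$, let $((X_n,Y_n))_{n\in\mathbb{Z}_+}$ be IID, each uniformly distributed on $\{0,\dots,\max_i c_i\}\times\{1,\dots,L\}$. Put $Z_n=(X_n,Y_n,Y_{n+1})$; under $P$, $Z=(Z_n)$ is a Markov chain whose transition function is also denoted by $P$: $P((a,b,b'),(a',b',b''))=\frac{1}{(\max_i c_i+1)L}$, all other entries being $0$. Let $${\cal L}=\{(x,j,j'): (x<c_j \text{ and } j'=1)\text{ or }(j<L,\ x=c_j,\ j'=j+1)\},\qquad {\cal L}_0={\cal L}\cap\{(x,1,j'):x>0\},$$ where $x\in\{0,\dots,\max_i c_i\}$ and $j,j'\in\{1,\dots,L\}$. Let $\tau=0$ if $Z_0\notin{\cal L}_0$ and $\tau=\inf\{n: Z_n\notin{\cal L}\}$ otherwise. For $n\in\mathbb{Z}_+$, $Q_n$ is the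 probability measure $Q_n(B)=P(B\mid\tau>n)$ on the $\sigma$-algebra generated by $Z_0,\dots,Z_n$, with expectation $E^{Q_n}$. The restriction $P_{\cal L}$ of the transition function $P$ to ${\cal L}\times{\cal L}$ is an irreducible aperiodic substochastic matrix. Let $\lambda_c\in(0,1)$ be its Perron root, with strictly positive left and right eigenvectors $\nu_c$ and $\varphi_c$, normalized so that $\varphi_c$ and the pointwise product $\nu_c\varphi_c$ are probability measures on ${\cal L}$. Define the stochastic transition function $Q$ on ${\cal L}\times{\cal L}$ by $Q(z,z')=\frac{1}{\lambda_c\varphi_c(z)}P_{\cal L}(z,z')\varphi_c(z')$. $E^Q_\mu$ denotes expectation for the Markov chain $Z$ on ${\cal L}$ with transition function $Q$ and initial distribution $\mu$. *)

(* Defs.v *)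
From HB Require Import structures.
From mathcomp Require Import all_boot all_order all_algebra finmap.
From mathcomp Require Import complex.
From mathcomp Require Import all_classical all_reals all_analysis.

Set Implicit Arguments.
Unset Strict Implicit.
Unset Printing Implicit Defensive.

Import Order.TTheory GRing.Theory Num.Theory.

Local Open Scope classical_set_scope.
Local Open Scope ring_scope.

Section probability.
Context d (Om : measurableType d) (R : realType).

(* Integral of a complex function; the set function [mu] is only used when it
   is a probability measure and [X] takes finitely many values. *)
Definition cexpectation (mu : set Om -> \bar R) (X : Om -> R[i]) : R[i] :=
  Complex (fine (\int[mu]_w (complex.Re (X w))%:E)%E)
          (fine (\int[mu]_w (complex.Im (X w))%:E)%E).

Definition cond_prob (P : probability Om R) (A : set Om) : set Om -> \bar R :=
  fun B => (P (B `&` A) * ((fine (P A))^-1)%:E)%E.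

(* [T] carries the sigma-algebra of all its subsets. *)
Definition random_elements (T : finType) (V : nat -> Om -> T) : Prop :=
  forall (n : nat) (A : set T), measurable (V n @^-1` A).

Definition independent (P : probability Om R) (T : finType)
    (V : nat -> Om -> T) : Prop :=
  forall (J : {fset nat}) (A : nat -> set T),
    P (\bigcap_(k in [set` J]) (V k @^-1` A k))
    = (\prod_(k <- J) P (V k @^-1` A k))%E.

Definition iid_uniform (P : probability Om R) (T : finType)
    (V : nat -> Om -> T) : Prop :=
  [/\ random_elements V,
      independent P V &
      forall (n : nat) (t : T), P (V n @^-1` [set t]) = (#|T|%:R^-1)%:E].

Definition cylinder (T : Type) (V : nat -> Om -> T) (z : nat -> T) (n : nat) :
    set Om :=
  [set w | forall k : nat, (k <= n)%N -> V k w = z k].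

Definition markov_chain (P : probability Om R) (T : finType)
    (V : nat -> Om -> T) (mu : T -> R) (K : T -> T -> R) : Prop :=
  [/\ random_elements V,
      forall t : T, P (V 0 @^-1` [set t]) = (mu t)%:E &
      forall (n : nat) (z : nat -> T), (0 < P (cylinder V z n))%E ->
        cond_prob P (cylinder V z n) (V n.+1 @^-1` [set z n.+1])
        = (K (z n) (z n.+1))%:E].

End probability.

Definition kernel_mx (R : realType) (T : finType) (K : T -> T -> R) :
    'M[R]_#|T| :=
  \matrix_(i, j) K (enum_val i) (enum_val j).

Definition perron_root (R : realType) (m : nat) (A : 'M[R]_m) (lam : R) :
    Prop :=
  eigenvalue (map_mx (real_complex R) A) (real_complex R lam) /\
  forall a : R[i], eigenvalue (map_mx (real_complex R) A) a ->
    `|a| <= real_complex R lam.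

(* L is [l.+1], and the index j in {1, ..., L} is the ordinal j - 1; thus
   c_1 = c ord0, c_L = c ord_max, and "j < L" reads [j < l]. *)
Section model.
Context (l : nat) (c : 'I_l.+1 -> nat).

Definition maxc : nat := (\max_(j < l.+1) c j)%N.

Definition XYstate : finType := ('I_maxc.+1 * 'I_l.+1)%type.

Definition state : finType := ('I_maxc.+1 * 'I_l.+1 * 'I_l.+1)%type.

Definition calL : {set state} :=
  [set z : state | let: (x, j, j') := z in
     ((x < c j)%N && (j' == ord0))
     || [&& (j < l)%N, (x == c j :> nat) & (j' == j.+1 :> nat)]].

Definition calL0 : {set state} :=
  [set z in calL | let: (x, j, j') := z in (j == ord0) && (0 < x)%N].

Definition Lstate : finType := {z : state | z \in calL}.

Context (R : realType).

Definition transP (z z' : state) : R :=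
  if z.2 == z'.1.2 then (maxc.+1%:R * l.+1%:R)^-1 else 0.

Definition transPL (z z' : Lstate) : R := transP (val z) (val z').

Definition perron_triple (lam : R) (nu phi : Lstate -> R) : Prop :=
  let A := kernel_mx transPL in
  let row_nu := \row_i nu (enum_val i) in
  let col_phi := \col_i phi (enum_val i) in
  [/\ perron_root A lam, 0 < lam < 1,
      (forall z, 0 < nu z) /\ (forall z, 0 < phi z),
      row_nu *m A = lam *: row_nu /\ A *m col_phi = lam *: col_phi &
      \sum_z phi z = 1 /\ \sum_z nu z * phi z = 1].

Definition transQ (lam : R) (phi : Lstate -> R) (z z' : Lstate) : R :=
  (lam * phi z)^-1 * transPL z z' * phi z'.

Definition phi_tilde (phi : Lstate -> R) (z : Lstate) : R :=
  if val z \in calL0 then phi z / \sum_(z' | val z' \in calL0) phi z' else 0.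

Context d (Om : measurableType d).
Variables (X : nat -> Om -> 'I_maxc.+1) (Y : nat -> Om -> 'I_l.+1).

Definition Zproc (n : nat) (w : Om) : state := (X n w, Y n w, Y n.+1 w).

(* The infimum of the empty set is +oo. *)
Definition tau (w : Om) : \bar R :=
  if Zproc 0 w \notin calL0 then 0%E
  else ereal_inf [set (n%:R)%:E | n in [set n : nat | Zproc n w \notin calL]].

Definition events_upto (n : nat) : set (set Om) :=
  [set B | exists k : nat, (k <= n)%N /\
     exists A : set state, B = Zproc k @^-1` A].

(* The type of the argument makes this a set function on the sigma-algebra
   generated by Z_0, ..., Z_n rather than on that of [Om]. *)
Definition Qmeasure (P : probability Om R) (n : nat) :
    set (g_sigma_algebraType (events_upto n)) -> \bar R :=
  cond_prob P [set w | ((n%:R)%:E < tau w)%E].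

End model.

Arguments Qmeasure {l c R d Om} X Y P n _.

(* Main.v *)
Require Import Defs.
From HB Require Import structures.
From mathcomp Require Import all_boot all_order all_algebra finmap.
From mathcomp Require Import complex.
From mathcomp Require Import all_classical all_reals all_analysis.

Set Implicit Arguments.
Unset Strict Implicit.
Unset Printing Implicit Defensive.

Import Order.TTheory GRing.Theory Num.Theory.

Local Open Scope classical_set_scope.
Local Open Scope ring_scope.

(** Both sides of the identity are averages over the finitely many paths
    [z_0, ..., z_n] that start in [calL0] and stay in [calL], and both give
    such a path a mass proportional to the same weight
    [\prod_(k < n) transP (z_k, z_(k+1))].

    For the conditioned IID sequence, the event [n < tau] says exactly that the
    path of [Z] is of this kind ([survival_event]), and each path of [Z] has
    probability [C * weight], where [C] is the constant mass of the law of
    [Z_0] ([Zproc_cylinder]). Conditioning divides by the total mass, so [C]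
    cancels ([cexpectation_Qmeasure]).

    For the chain with kernel [transQ], the Doob transform of [transPL] by the
    positive function [phi], the ratios [phi z_(k+1) / phi z_k] telescope
    along the path ([prod_transQ]). Started from [phi] conditioned on [calL0],
    it follows the path with probability
    [phi z_n * weight / (lam ^+ n * S)], where [S] is the mass of [calL0] under
    [phi]. Dividing by [phi z_n] leaves the weight up to a nonzero constant
    ([cexpectation_tilted]), and this constant disappears in the quotient of
    the two expectations. *)

(** * Finitely valued random elements *)

Section finite_valued.
Context d (T : measurableType d) (R : realType) (S : finType) (g : T -> S).

Lemma integral_finite_valued (mu : {measure set T -> \bar R}) (f : S -> R) :
    (mu setT < +oo)%E -> (forall s, measurable (g @^-1` [set s])) ->
  (\int[mu]_w (f (g w))%:E =
     (\sum_s f s * fine (mu (g @^-1` [set s])))%:E)%E.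
Proof.
move=> muT mg.
have mu_fin s : mu (g @^-1` [set s]) \is a fin_num.
  rewrite ge0_fin_numE//; apply: le_lt_trans muT.
  by apply: le_measure; rewrite ?inE.
have int1 s : mu.-integrable setT (EFin \o \1_(g @^-1` [set s])).
  apply: measurable_bounded_integrable => //.
  exists 1; split=> // x x1 w _ /=; apply: le_trans (ltW x1).
  by rewrite indicE; case: (_ \in _); rewrite ?normr1 ?normr0.
transitivity (\int[mu]_w
    \sum_s (f s)%:E * (EFin \o \1_(g @^-1` [set s])) w)%E.
  apply: eq_integral => w _; rewrite (bigD1 (g w))//= big1.
    by rewrite indicE mem_set// mule1 adde0.
  move=> s /eqP sg; rewrite indicE memNset ?mule0//.
  by move=> /= gs; apply: sg.
rewrite integral_sum//; last by move=> s; exact: integrableZl.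
rewrite -sumEFin; apply: eq_bigr => s _.
by rewrite integralZl// integral_indic// setIT EFinM fineK.
Qed.

Lemma fine_measure_preimage (mu : {measure set T -> \bar R}) (A : {pred S}) :
    (mu setT < +oo)%E -> (forall s, measurable (g @^-1` [set s])) ->
    measurable (g @^-1` [set s | s \in A]) ->
  fine (mu (g @^-1` [set s | s \in A])) =
    \sum_(s in A) fine (mu (g @^-1` [set s])).
Proof.
move=> muT mg mA.
have := integral_finite_valued (fun s => (s \in A)%:R) muT mg.
rewrite (eq_integral (EFin \o \1_(g @^-1` [set s | s \in A]))); last first.
  by move=> w _; rewrite /= indicE mem_setE.
rewrite integral_indic// setIT => ->.
rewrite /= [RHS]big_mkcond; apply: eq_bigr => s _.
by case: (s \in A); rewrite ?mul1r ?mul0r.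
Qed.

Lemma cexpectation_finite_valued (mu : {measure set T -> \bar R})
    (f : S -> R[i]) :
    (mu setT < +oo)%E -> (forall s, measurable (g @^-1` [set s])) ->
  cexpectation mu (fun w => f (g w)) =
    \sum_s f s * real_complex R (fine (mu (g @^-1` [set s]))).
Proof.
move=> muT mg; rewrite /cexpectation.
rewrite (integral_finite_valued (fun s => complex.Re (f s)))//.
rewrite (integral_finite_valued (fun s => complex.Im (f s)))//=.
apply: (big_rec3 (fun x y z => Complex x y = z)) => // s x y z _ <-.
case: (f s) => a b; apply/eqP; rewrite eq_complex /=.
by rewrite !mulr0 subr0 add0r !eqxx.
Qed.

End finite_valued.

(** * Trajectories with values in a finite set *)

Section trajectories.
Context d (Om : measurableType d) (R : realType) (T : finType).
Implicit Types (V : nat -> Om -> T) (P : probability Om R).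

Definition trajectory V (n : nat) (w : Om) : {ffun 'I_n.+1 -> T} :=
  [ffun k : 'I_n.+1 => V k w].

Lemma preimage_trajectory V n p :
  trajectory V n @^-1` [set p] = cylinder V (fun k => p (inord k)) n.
Proof.
apply/seteqP; split=> w /=.
  by move=> <- k kn; rewrite /trajectory ffunE inordK.
move=> Vp; apply/ffunP => k; rewrite ffunE Vp ?inord_val//.
by rewrite -ltnS.
Qed.

Lemma measurable_cylinder V z n :
    (forall k t, (k <= n)%N -> measurable (V k @^-1` [set t])) ->
  measurable (cylinder V z n).
Proof.
move=> mV.
rewrite (_ : cylinder _ _ _ = \bigcap_(k in `I_n.+1) (V k @^-1` [set z k])).
  by apply: fin_bigcap_measurable => // k kn; exact: mV.
by apply/seteqP; split=> w /= H k kn; exact: H.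
Qed.

Lemma measurable_trajectory V n (A : set {ffun 'I_n.+1 -> T}) :
    (forall k t, (k <= n)%N -> measurable (V k @^-1` [set t])) ->
  measurable (trajectory V n @^-1` A).
Proof.
move=> mV.
rewrite (_ : _ @^-1` A = \bigcup_(p in A) trajectory V n @^-1` [set p]).
  apply: fin_bigcup_measurable => // p _.
  by rewrite preimage_trajectory; exact: measurable_cylinder.
by apply/seteqP; split=> [w Aw|w [p Ap /= ->]]//; exists (trajectory V n w).
Qed.

Lemma markov_chain_cylinder P V mu K (z : nat -> T) (n : nat) :
    markov_chain P V mu K ->
  P (cylinder V z n) = (mu (z 0) * \prod_(k < n) K (z k) (z k.+1))%:E.
Proof.
move=> [mV V0 VS].
have mC m : measurable (cylinder V z m).
  by apply: measurable_cylinder => k t _; exact: mV.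
elim: n => [|n IH].
  rewrite big_ord0 mulr1 -V0; congr (P _).
  by apply/seteqP; split=> w /= => [->//|wz k]; rewrite leqn0 => /eqP->.
have CS : cylinder V z n.+1 = V n.+1 @^-1` [set z n.+1] `&` cylinder V z n.
  apply/seteqP; split=> w /=.
    by move=> H; split=> [|k kn]; apply: H => //; exact: leqW.
  by move=> [Hn H] k; rewrite leq_eqVlt => /orP[/eqP->//|]; exact: H.
rewrite big_ord_recr/= mulrA.
(* The transition rule is silent on null cylinders; there both sides vanish. *)
have [C0|Cn0] := eqVneq (P (cylinder V z n)) 0%E.
  move: IH; rewrite C0 => -[<-]; rewrite mul0r CS.
  apply/eqP; rewrite eq_le measure_ge0 andbT -[leRHS]C0.
  by apply: le_measure; rewrite ?inE//; apply: measurableI => //; exact: mV.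
have Cgt0 : (0 < P (cylinder V z n))%E by rewrite lt0e Cn0/=.
move: (VS n z Cgt0); rewrite /cond_prob -CS IH/= => PC.
move: Cn0; rewrite IH eqe => Cn0.
move: PC; set a := _ * \prod_(i < n) _ in Cn0 *.
have : P (cylinder V z n.+1) \is a fin_num by exact: fin_num_measure.
move/fineK => <-; set b := fine _.
rewrite -EFinM => -[<-]; congr EFin.
by rewrite mulrCA divff ?mulr1.
Qed.

End trajectories.

(** * Conditional probability on a smaller sigma-algebra *)

(** [cond_prob P A] is a mere set function, while integration theory needs a
    measure on the sigma-algebra generated by [G]. It is one as the image,
    under the identity map, of the rescaled restriction of [P] to [A]. *)
Lemma cond_prob_is_measure d (Om : measurableType d) (R : realType)
    (P : probability Om R) (A : set Om) (G : set (set Om)) :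
    measurable A -> (G `<=` measurable) ->
  exists2 m : {measure set (g_sigma_algebraType G) -> \bar R},
    (m setT < +oo)%E & cond_prob P A = m :> (set Om -> \bar R).
Proof.
move=> mA GM.
have mid : measurable_fun setT (idfun : Om -> g_sigma_algebraType G).
  move=> _ B mB; rewrite setTI; move: B mB; apply: smallest_sub GM.
  exact: sigma_algebra_measurable.
have r0 : 0 <= (fine (P A))^-1 by rewrite invr_ge0 fine_ge0.
pose m0 : {measure set Om -> \bar R} := mscale (NngNum r0) (mrestr P mA).
unshelve eexists (pushforward m0 (idfun : Om -> g_sigma_algebraType G)
  : {measure set (g_sigma_algebraType G) -> \bar R}).
- exact: mid.
- rewrite /= /pushforward /= /mscale /= /mrestr preimage_setT setTI.
  by rewrite -(fineK (fin_num_measure P A mA)) -EFinM ltry.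
- by apply/funext => B; rewrite /cond_prob /= /pushforward /mscale/= muleC.
Qed.

(** * Sums over surviving paths *)

Section survival.
Context (l : nat) (c : 'I_l.+1 -> nat) (R : realType).

Definition surviving (n : nat) : {set {ffun 'I_n.+1 -> state c}} :=
  [set p : {ffun 'I_n.+1 -> state c} |
    (p ord0 \in calL0 c) && [forall k, p k \in calL c]]%SET.

(** The product of the transition probabilities without the initial mass,
    which is constant for the IID sequence. *)
Definition path_weight (n : nat) (p : 'I_n.+1 -> state c) : R :=
  \prod_(k < n) transP R (p (inord k)) (p (inord k.+1)).

(** The common value, up to a constant, of the unnormalized expectations in
    the two models. *)
Definition survival_sum (n : nat) (F : ('I_n.+1 -> state c) -> R[i]) : R[i] :=
  \sum_(p in surviving n) F p * real_complex R (path_weight p).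

(** The tilted chain lives on the subtype [Lstate c], the IID sequence on
    [state c]; [val] identifies paths in the former with surviving ones. *)
Lemma survival_sum_Lstate (n : nat) (F : ('I_n.+1 -> state c) -> R[i]) :
  survival_sum F =
    \sum_(q : {ffun 'I_n.+1 -> Lstate c} | val (q ord0) \in calL0 c)
      F (fun k => val (q k)) * real_complex R (path_weight (fun k => val (q k))).
Proof.
pose h (q : {ffun 'I_n.+1 -> Lstate c}) := [ffun k => val (q k)].
have h_inj : injective h.
  move=> q q' /ffunP hq; apply/ffunP => k; apply: val_inj.
  by have := hq k; rewrite !ffunE.
pose A := [pred q : {ffun 'I_n.+1 -> Lstate c} | val (q ord0) \in calL0 c].
have -> : survival_sum F = \sum_(p in [set h q | q in A]%SET)
    F p * real_complex R (path_weight p).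
  apply: eq_bigl => p; rewrite inE; apply/idP/imsetP.
    move=> /andP[p0 /forallP pL].
    exists [ffun k => exist _ (p k) (pL k)]; first by rewrite inE/= ffunE.
    by apply/ffunP => k; rewrite !ffunE.
  move=> [q]; rewrite inE => q0 ->; rewrite /h ffunE q0/=.
  by apply/forallP => k; rewrite ffunE; exact: valP.
rewrite big_imset/=; last by move=> q q' _ _; exact: h_inj.
apply: eq_bigr => q _.
by rewrite (_ : h q = (fun k => val (q k)) :> (_ -> _))//; apply/funext => k;
  rewrite ffunE.
Qed.

End survival.

(** * The conditioned IID sequence *)

Section uniform_letters.
Context (R : realType) (l : nat) (c : 'I_l.+1 -> nat).
Context d (Om : measurableType d) (P : probability Om R).
Variables (X : nat -> Om -> 'I_(maxc c).+1) (Y : nat -> Om -> 'I_l.+1).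
Let V k w : XYstate c := (X k w, Y k w).
Let Z := Zproc X Y.

Lemma measurable_Zproc k (A : set (state c)) :
  random_elements V -> measurable (Z k @^-1` A).
Proof.
move=> mV.
pose h (p : {ffun 'I_k.+2 -> XYstate c}) : state c :=
  (p (inord k), (p (inord k.+1)).2).
rewrite (_ : _ @^-1` A = trajectory V k.+1 @^-1` (h @^-1` A)).
  by apply: measurable_trajectory => j t _; exact: mV.
by apply/seteqP; split=> w; rewrite /= /h !ffunE !inordK.
Qed.

(** A path whose overlapping coordinates agree determines the letters
    [(X_k, Y_k)] for [k <= n], and of the letter [n.+1] only the [Y] part.
    Otherwise the cylinder is empty and some transition probability is zero. *)
Lemma Zproc_cylinder (z : nat -> state c) (n : nat) : iid_uniform P V ->
  P (cylinder Z z n) =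
    (((maxc c).+1%:R * l.+1%:R * l.+1%:R)^-1 *
       \prod_(k < n) transP R (z k) (z k.+1))%:E.
Proof.
move=> [mV indV unifV].
have [/forallP zc|/forallPn[k /eqP zk]] :=
    boolP [forall k : 'I_n, (z k).2 == (z k.+1).1.2]; last first.
  rewrite (bigD1 k)//= {1}/transP; case: eqP => // _.
  rewrite mul0r mulr0 (_ : cylinder _ _ _ = set0) ?measure0//.
  apply/seteqP; split=> w //= Zw; apply: zk.
  by rewrite -!Zw//; exact: ltnW.
pose A k : set (XYstate c) :=
  if (k <= n)%N then [set (z k).1] else [set t | t.2 == (z n).2].
pose J := [fset k in iota 0 n.+2]%fset.
have memJ k : (k \in J) = (k < n.+2)%N by rewrite in_fset mem_iota.
have -> : cylinder Z z n = \bigcap_(k in [set` J]) (V k @^-1` A k).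
  apply/seteqP; split=> w /=.
    move=> Zw k; rewrite /= memJ ltnS /A => kn1.
    case: (leqP k n) => [kn|nk] /=; first by rewrite -Zw.
    have -> : k = n.+1 by apply/eqP; rewrite eqn_leq kn1.
    by rewrite -Zw.
  move=> Vw k kn.
  have zj j : (j <= n)%N -> (X j w, Y j w) = (z j).1.
    by move=> jn; have := Vw j; rewrite /= memJ /A jn; apply; exact: leqW.
  rewrite /Z /Zproc zj// [RHS]surjective_pairing; congr pair.
  move: kn; rewrite leq_eqVlt => /orP[/eqP->|kn].
    by have := Vw n.+1; rewrite /= memJ /A ltnn => /(_ (ltnSn _))/eqP.
  by rewrite (eqP (zc (Ordinal kn)))/= -zj.
rewrite indV (perm_big (iota 0 n.+2)); last first.
  by apply: uniq_perm; rewrite ?iota_uniq ?fset_uniq// => k; rewrite memJ mem_iota.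
pose u : R := #|XYstate c|%:R^-1.
have PA k : (k <= n)%N -> P (V k @^-1` A k) = u%:E.
  by move=> kn; rewrite /A kn unifV.
(* One free coordinate: [maxc c + 1] equally likely letters remain. *)
have PAS : P (V n.+1 @^-1` A n.+1) = (l.+1%:R^-1)%:E.
  pose B := [pred t : XYstate c | t.2 == (z n).2].
  rewrite /A ltnn -[LHS]fineK; last exact: fin_num_measure.
  congr EFin.
  rewrite (@fine_measure_preimage _ _ _ _ (V n.+1) P B)//=.
  - rewrite (eq_bigr (fun=> u)) => [|t _]; last by rewrite unifV.
    rewrite sumr_const.
    rewrite (_ : #|B| = (maxc c).+1); last first.
      rewrite -(card_ord (maxc c).+1) -[RHS]muln1 -(card1 (z n).2) -cardX.
      by apply: eq_card => t; rewrite !inE.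
    rewrite -[LHS]mulr_natr /u card_prod !card_ord natrM invfM mulrAC.
    by rewrite mulVf ?mul1r// pnatr_eq0.
  - by rewrite (le_lt_trans (probability_le1 _ _))// ltry.
rewrite -(addn1 n.+1) iotaD big_cat/= big_seq1 add0n PAS.
rewrite (_ : \prod_(k <- iota 0 n.+1) _ = (u ^+ n.+1)%:E)%E; last first.
  rewrite (eq_big_seq (fun=> u%:E)) => [|k]; last first.
    by rewrite mem_iota ltnS => kn; rewrite PA.
  by rewrite prodEFin big_const_seq count_predT size_iota iter_mulr_1.
rewrite (eq_bigr (fun=> u)); last first.
  move=> k _; rewrite /transP zc /u card_prod !card_ord natrM//.
rewrite prodr_const card_ord -EFinM exprSr /u card_prod !card_ord natrM.
by congr EFin; rewrite [RHS]mulrC -[LHS]mulrA -(invfM (_ * _)).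
Qed.

(** On [calL0], which lies in [calL], [tau] is the infimum of the exit times;
    these are integers, so that avoiding [0, ..., n] bounds it below by
    [n.+1]. *)
Lemma survival_event (n : nat) :
  [set w | ((n%:R)%:E < tau R X Y w)%E] =
    trajectory Z n @^-1` [set p | p \in surviving c n].
Proof.
apply/seteqP; split=> w /=.
  rewrite /tau; case: ifPn => [_|]; first by rewrite lte_fin ltrn0.
  rewrite negbK => Z0 ntau; rewrite inE /= ffunE Z0/=.
  apply/forallP => k; rewrite ffunE; apply: contraTT ntau => Zk.
  rewrite -leNgt; apply: (@le_trans _ _ (k%:R)%:E).
    by apply: ereal_inf_lbound; exists (k : nat).
  by rewrite lee_fin ler_nat -ltnS.
rewrite inE /= ffunE /tau => /andP[Z0 /forallP ZL]; rewrite Z0/=.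
apply: (@lt_le_trans _ _ (n.+1%:R)%:E); first by rewrite lte_fin ltr_nat.
apply: le_ereal_inf_tmp => _ [m/= Zm <-]; rewrite lee_fin ler_nat ltnNge.
apply: contra Zm => mn; have := ZL (Ordinal (mn : m < n.+1)%N).
by rewrite ffunE.
Qed.

Lemma trajectory_cylinder (n : nat) (p : {ffun 'I_n.+1 -> state c}) :
    iid_uniform P V ->
  fine (P (trajectory Z n @^-1` [set p])) =
    ((maxc c).+1%:R * l.+1%:R * l.+1%:R)^-1 * path_weight R p.
Proof. by move=> iidV; rewrite preimage_trajectory Zproc_cylinder. Qed.

Lemma cexpectation_Qmeasure (n : nat) (F : ('I_n.+1 -> state c) -> R[i]) :
    iid_uniform P V ->
  cexpectation (Qmeasure X Y P n) (fun w => F (fun k => Z k w)) =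
    survival_sum F / survival_sum (fun _ : 'I_n.+1 -> state c => 1).
Proof.
move=> iidV; have [mV _ _] := iidV.
have mZ k (A : set (state c)) : measurable (Z k @^-1` A).
  exact: measurable_Zproc.
set A := [set w | ((n%:R)%:E < tau R X Y w)%E].
have Asurv : A = trajectory Z n @^-1` [set p | p \in surviving c n].
  exact: survival_event.
have mtraj (B : set {ffun 'I_n.+1 -> state c}) :
  measurable (trajectory Z n @^-1` B).
  by apply: measurable_trajectory => k t _; exact: mZ.
have mA : measurable A by rewrite Asurv.
have GM : events_upto X Y n `<=` @measurable _ Om.
  by move=> _ [k [_ [B ->]]]; exact: mZ.
have [m m_fin Qm] := cond_prob_is_measure P mA GM.
pose Om_n := g_sigma_algebraType (events_upto X Y n).
(* Integrals are taken over the sigma-algebra generated by [Z_0, ..., Z_n], so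
   the trajectory has to be measurable for it too. *)
have mtraj_n p : measurable (trajectory (Z : nat -> Om_n -> _) n @^-1` [set p]).
  apply: measurable_trajectory => k t kn; apply: sub_gen_smallest.
  by exists k; split=> //; exists [set t].
pose C : R := ((maxc c).+1%:R * l.+1%:R * l.+1%:R)^-1.
have C_neq0 : C != 0 by rewrite invr_eq0 !mulf_neq0// pnatr_eq0.
pose w1 : R := \sum_(p in surviving c n) path_weight R p.
have PA : fine (P A) = C * w1.
  rewrite Asurv fine_measure_preimage//; last first.
    by rewrite (le_lt_trans (probability_le1 _ _))// ltry.
  by rewrite mulr_sumr; apply: eq_bigr => p _; exact: trajectory_cylinder.
have sum1 : survival_sum (fun _ : 'I_n.+1 -> state c => 1) = real_complex R w1.
  by rewrite rmorph_sum; apply: eq_bigr => p _; rewrite mul1r.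
have cond p : fine (cond_prob P A (trajectory Z n @^-1` [set p])) =
    if p \in surviving c n then path_weight R p / w1 else 0.
  rewrite /cond_prob Asurv; case: ifPn => ps.
    rewrite setIidl; last by move=> w /= ->.
    rewrite -[X in fine (X * _)]fineK; last exact: fin_num_measure.
    rewrite -EFinM/= -Asurv PA trajectory_cylinder// -/C.
    by rewrite invfM mulrACA divff// mul1r.
  rewrite (_ : _ `&` _ = set0) ?measure0 ?mul0e//.
  by apply/seteqP; split=> w //= [->]; apply/negP.
rewrite /Qmeasure -/A Qm.
rewrite (_ : (fun w => F (fun k => Z k w)) =
    (fun w => F (trajectory (Z : nat -> Om_n -> _) n w))); last first.
  by apply/funext => w; congr F; apply/funext => k; rewrite ffunE.
rewrite (cexpectation_finite_valued
  (fun p : {ffun 'I_n.+1 -> state c} => F p) m_fin mtraj_n).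
rewrite sum1 /survival_sum mulr_suml [RHS]big_mkcond; apply: eq_bigr => p _.
rewrite -Qm cond; case: ifP => _; last by rewrite rmorph0 mulr0.
by rewrite rmorphM fmorphV mulrA.
Qed.

End uniform_letters.

(** * The tilted chain *)

Section tilted_chain.
Context (R : realType) (l : nat) (c : 'I_l.+1 -> nat).
Context (lam : R) (phi : Lstate c -> R).
Context d (Om : measurableType d) (Q : probability Om R).
Context (W : nat -> Om -> Lstate c).

(** Each factor [phi (z k)] of a product of [transQ] is cancelled by the next
    one, which leaves only the two end points of the path. *)
Lemma prod_transQ (z : nat -> Lstate c) (n : nat) : (forall z, 0 < phi z) ->
  phi (z 0) * \prod_(k < n) transQ lam phi (z k) (z k.+1) =
    lam ^- n * (\prod_(k < n) transPL R (z k) (z k.+1)) * phi (z n).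
Proof.
move=> phi_gt0; elim: n => [|n IH]; first by rewrite !big_ord0 expr0 invr1 !mul1r mulr1.
rewrite !big_ord_recr/= mulrA IH /transQ exprSr !invfM.
have pn0 : phi (z n) != 0 by rewrite gt_eqF.
set p := \prod_(_ < n) _; set a := lam ^- n; set t := transPL _ _ _.
rewrite -!mulrA; congr (a * _); rewrite [RHS]mulrCA; congr (p * _).
by rewrite mulrCA mulVKf.
Qed.

(** With a zero sum, [phi_tilde phi] would vanish identically, because
    division by zero yields zero, and could not be the law of [W 0]. *)
Lemma phi_calL0_neq0 : markov_chain Q W (phi_tilde phi) (transQ lam phi) ->
  \sum_(z : Lstate c | val z \in calL0 c) phi z != 0.
Proof.
move=> [mW W0 _].
have {}W0 t : Q (W 0%N @^-1` [set t]) = (phi_tilde phi t)%:E := W0 t.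
apply/eqP => S0.
have : fine (Q (W 0 @^-1` [set z | z \in predT])) = 0.
  rewrite (@fine_measure_preimage _ _ _ _ (W 0%N) Q predT)//=; last first.
    by rewrite (le_lt_trans (probability_le1 _ _))// ltry.
  rewrite big1// => z _.
  by rewrite W0 /phi_tilde S0 invr0 mulr0; case: ifP.
rewrite (_ : _ @^-1` _ = setT) ?probability_setT.
  by move=> /eqP; rewrite oner_eq0.
by apply/seteqP; split.
Qed.

(** Dividing by [phi (W n w)] removes the end point factor left by
    [prod_transQ], and the initial law supplies the one at the starting point:
    every path is thus charged its [path_weight], up to one constant. *)
Lemma cexpectation_tilted (n : nat) (F : ('I_n.+1 -> state c) -> R[i]) :
    (forall z, 0 < phi z) ->
    markov_chain Q W (phi_tilde phi) (transQ lam phi) ->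
  cexpectation Q
      (fun w => F (fun k => val (W k w)) / real_complex R (phi (W n w))) =
    real_complex R (lam ^- n / \sum_(z : Lstate c | val z \in calL0 c) phi z) *
      survival_sum F.
Proof.
move=> phi_gt0 hW; have [mW _ _] := hW.
pose f (q : {ffun 'I_n.+1 -> Lstate c}) : R[i] :=
  F (fun k => val (q k)) / real_complex R (phi (q ord_max)).
rewrite (_ : (fun w => _) = (fun w => f (trajectory W n w))); last first.
  apply/funext => w; rewrite /f ffunE; congr (F _ / _).
  by apply/funext => k; rewrite ffunE.
rewrite cexpectation_finite_valued; last 2 first.
- by rewrite (le_lt_trans (probability_le1 _ _))// ltry.
- by move=> q; apply: measurable_trajectory => k t _; exact: mW.
rewrite survival_sum_Lstate mulr_sumr [RHS]big_mkcond/=.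
apply: eq_bigr => q _.
rewrite preimage_trajectory (markov_chain_cylinder _ _ hW)/= /phi_tilde.
have -> : inord 0 = ord0 :> 'I_n.+1 by apply: val_inj; rewrite /= inordK.
case: ifP => _; last by rewrite mul0r rmorph0 mulr0.
rewrite /f -mulrA -fmorphV -rmorphM [RHS]mulrCA -rmorphM.
congr (_ * real_complex R _).
have := prod_transQ (fun k => q (inord k)) n phi_gt0.
have -> : inord 0 = ord0 :> 'I_n.+1 by apply: val_inj; rewrite /= inordK.
have -> : inord n = ord_max :> 'I_n.+1 by apply: val_inj; rewrite /= inordK.
move=> Qweight; rewrite [phi _ / _ * _]mulrAC Qweight mulrCA.
by rewrite mulrA mulfK ?gt_eqF// mulrAC.
Qed.

End tilted_chain.

Theorem theorem2p2 (R : realType) (l : nat) (c : 'I_l.+1 -> nat)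
    (hc : (0 < c ord0 * c ord_max)%N)
    (hLc : (l.+1, c ord0) <> (1%N, 1%N))
    (d : measure_display) (Om : measurableType d) (P : probability Om R)
    (X : nat -> Om -> 'I_(maxc c).+1) (Y : nat -> Om -> 'I_l.+1)
    (hXY : iid_uniform P (fun k w => ((X k w, Y k w) : XYstate c)))
    (lam : R) (nu phi : Lstate c -> R)
    (hperron : perron_triple lam nu phi)
    (d' : measure_display) (Om' : measurableType d') (Q : probability Om' R)
    (W : nat -> Om' -> Lstate c)
    (hW : markov_chain Q W (phi_tilde phi) (transQ lam phi))
    (n : nat) (F : ('I_n.+1 -> state c) -> R[i]) :
  cexpectation (Qmeasure X Y P n)
    (fun w => F (fun k => Zproc X Y k w))
  = cexpectation Q
      (fun w => F (fun k => val (W k w)) / real_complex R (phi (W n w)))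
    / cexpectation Q (fun w => 1 / real_complex R (phi (W n w))).
Proof.
have [_ /andP[lam_gt0 _] [_ phi_gt0] _ _] := hperron.
rewrite (cexpectation_Qmeasure F hXY) (cexpectation_tilted F phi_gt0 hW).
rewrite (cexpectation_tilted (fun _ : 'I_n.+1 -> state c => 1) phi_gt0 hW).
set K := real_complex R _.
have K_neq0 : K != 0.
  rewrite fmorph_eq0 mulf_neq0 ?invr_eq0 ?(phi_calL0_neq0 hW)//.
  by rewrite expf_neq0// gt_eqF.
by rewrite invfM mulrACA divff// mul1r.
Qed.
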